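(* In the setting described in the context, let $\mathcal{W}$ be the set of all $w\in\mathbb{R}^{pT_{\mathrm{ini}}}$ such that $(u_{\mathrm{ini}},y_{\mathrm{ini}}-w)$ is a trajectory of $\mathcal{G}$, and let $\bar n_w=\mathrm{rank}(Y_p\mathcal{N}(U_p))$. Then $w\in\mathcal{W}$ if and only if there exists $g_w\in\mathbb{R}^{\bar n_w}$ such that $$w=-Y_p\,\mathcal{N}(U_p)\,\mathcal{R}\big(\mathcal{N}(U_p)^\top Y_p^\top\big)\,g_w+w_0 .$$ Moreover, the mapping $g_w\mapsto w$ from $\mathbb{R}^{\bar n_w}$ to $\mathcal{W}$ defined by this formula is bijective.
   Context: $\mathcal{G}$ is a controllable and observable discrete-time LTI system $x_{k+1}=Ax_k+Bu_k$, $y_k=Cx_k+Du_k$, with $x_k\in\mathbb{R}^n$, $u_k\in\mathbb{R}^m$, $y_k\in\mathbb{R}^p$. A finite sequence $\{u_k,y_k\}$ is a trajectory of $\mathcal{G}$ if some state sequence makes these equations hold. Finite sequences are identified with the column vectors obtained by stacking them. The lag $\mathbf{l}(\mathcal{G})$ is the smallest $l$ such that $[C^\top,A^\top C^\top,\dots,(A^{l-1})^\top C^\top]^\top$ has full column rank. For a sequence $v$ of length $T$, $\mathcal{H}_L(v)$ is the Hankel matrix with $L$ block rows whose $j$-th column stacks the entries $j,\dots,j+L-1$ of $v$ ($T-L+1$ columns); $v$ is persistently exciting of order $L$ if $\mathcal{H}_L(v)$ has full row rank. $(\bar u,\bar y)$ is a trajectory of $\mathcal{G}$ of length $T_d$,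 and $$\begin{bmatrix} U_p \\ U_f \end{bmatrix}=\mathcal{H}_{T_{\mathrm{ini}}+T_f}(\bar u),\qquad \begin{bmatrix} Y_p \\ Y_f \end{bmatrix}=\mathcal{H}_{T_{\mathrm{ini}}+T_f}(\bar y),$$ where $U_p,Y_p$ are the first $T_{\mathrm{ini}}$ block rows and $U_f,Y_f$ the last $T_f$ block rows. Standing assumptions: $\bar u$ is persistently exciting of order $T_{\mathrm{ini}}+T_f+n$ (so $U_p$ has full row rank) and $T_{\mathrm{ini}}\ge\mathbf{l}(\mathcal{G})$. The vectors $u_{\mathrm{ini}}\in\mathbb{R}^{mT_{\mathrm{ini}}}$ and $y_{\mathrm{ini}}\in\mathbb{R}^{pT_{\mathrm{ini}}}$ are given, and $w_0=y_{\mathrm{ini}}-Y_pg_{\mathrm{ini}}^*$ with $g_{\mathrm{ini}}^*=U_p^\top(U_pU_p^\top)^{-1}u_{\mathrm{ini}}$. For a matrix $X$, $\mathcal{N}(X)$ denotes a matrix whose columns form a basis of $\ker(X)$, and $\mathcal{R}(X)$ denotes a matrix whose columns form a basis of the column space of $X$. *)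

(* Defs.v *)
From HB Require Import structures.
From mathcomp Require Import all_boot all_order all_algebra.
From mathcomp Require Import classical_sets functions reals.

Set Implicit Arguments.
Unset Strict Implicit.
Unset Printing Implicit Defensive.

Import GRing.Theory.
Local Open Scope ring_scope.

Record ltiSystem (R : realType) (n m p : nat) := LtiSystem {
  ltiA : 'M[R]_n;
  ltiB : 'M[R]_(n, m);
  ltiC : 'M[R]_(p, n);
  ltiD : 'M[R]_(p, m) }.

(* The state sequence is a function on [nat] of which only x 0, ..., x T are
   constrained; since x T is free, asking for the state update also at time
   T - 1 does not restrict the pairs (u, y). *)
Definition runs (R : realType) (n m p : nat) (G : ltiSystem R n m p) (T : nat)
    (u : 'I_T -> 'cV[R]_m) (x : nat -> 'cV[R]_n) (y : 'I_T -> 'cV[R]_p) : Prop :=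
  forall k : 'I_T,
    x k.+1 = ltiA G *m x k + ltiB G *m u k /\
    y k = ltiC G *m x k + ltiD G *m u k.

Definition trajectory (R : realType) (n m p : nat) (G : ltiSystem R n m p)
    (T : nat) (u : 'I_T -> 'cV[R]_m) (y : 'I_T -> 'cV[R]_p) : Prop :=
  exists x : nat -> 'cV[R]_n, runs G u x y.

(* Any state can be steered to any other one in finite time (in discrete time
   this is stronger than steering every state to the origin). *)
Definition controllable (R : realType) (n m p : nat)
    (G : ltiSystem R n m p) : Prop :=
  forall x0 x1 : 'cV[R]_n,
    exists (T : nat) (u : 'I_T -> 'cV[R]_m) (x : nat -> 'cV[R]_n)
           (y : 'I_T -> 'cV[R]_p),
      [/\ runs G u x y, x 0%N = x0 & x T = x1].

(* The initial state is determined by finitely many inputs and outputs. *)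
Definition observable (R : realType) (n m p : nat)
    (G : ltiSystem R n m p) : Prop :=
  exists T : nat,
    forall (u : 'I_T -> 'cV[R]_m) (x x' : nat -> 'cV[R]_n)
           (y : 'I_T -> 'cV[R]_p),
      runs G u x y -> runs G u x' y -> x 0%N = x' 0%N.

Definition obs_mx (R : realType) (n m p : nat) (G : ltiSystem R n m p)
    (l : nat) :=
  \mxcol_(i < l) (ltiC G *m ltiA G ^+ i).

(* [row_full M] is [\rank M == number of columns of M]: full column rank. *)
Definition is_lag (R : realType) (n m p : nat) (G : ltiSystem R n m p)
    (l : nat) : Prop :=
  row_full (obs_mx G l) /\
  forall l' : nat, row_full (obs_mx G l') -> (l <= l')%N.

(* [mxvec] is row-major, so the entries of v k occupy the positions
   k * m, ..., k * m + m - 1. *)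
Definition stack (R : realType) (m L : nat) (v : 'I_L -> 'cV[R]_m) :
    'cV[R]_(L * m) :=
  (mxvec (\matrix_(k, a) v k a 0))^T.

Definition unstack (R : realType) (m L : nat) (v : 'cV[R]_(L * m)) :
    'I_L -> 'cV[R]_m :=
  fun k => (row k (vec_mx v^T))^T.

Lemma stackK (R : realType) (m L : nat) (v : 'I_L -> 'cV[R]_m) (k : 'I_L) :
  unstack (stack v) k = v k.
Proof. by rewrite /unstack /stack trmxK mxvecK; apply/matrixP=> a b; rewrite !mxE ord1. Qed.

Lemma unstackK (R : realType) (m L : nat) (v : 'cV[R]_(L * m)) :
  stack (unstack v) = v.
Proof.
rewrite /stack -[RHS]trmxK -[v^T in RHS]vec_mxK; congr (mxvec _)^T.
by apply/matrixP=> k a; rewrite /unstack !mxE.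
Qed.

Lemma hankel_subproof (T L : nat) (j : 'I_(T.+1 - L)) (k : 'I_L) :
  (j + k < T)%N.
Proof.
have := ltn_ord j; rewrite ltn_subRL addnC ltnS => h.
by apply: leq_trans h; rewrite ltn_add2l.
Qed.

Definition hankel_ord (T L : nat) (j : 'I_(T.+1 - L)) (k : 'I_L) : 'I_T :=
  Ordinal (hankel_subproof j k).

(* T.+1 - L is T - L + 1 when L <= T; for L > T there are no columns. *)
Definition hankel (R : realType) (m T L : nat) (v : 'I_T -> 'cV[R]_m) :
    'M[R]_(L * m, T.+1 - L) :=
  \matrix_(r, j) stack (fun k : 'I_L => v (hankel_ord j k)) r 0.

(* [row_free M] is [\rank M == number of rows of M]: full row rank. *)
Definition persistently_exciting (R : realType) (m T : nat) (L : nat)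
    (v : 'I_T -> 'cV[R]_m) : Prop :=
  row_free (hankel L v).

Definition columns_basis (R : realType) (d k : nat) (V : set 'cV[R]_d)
    (M : 'M[R]_(d, k)) : Prop :=
  row_full M /\ forall v : 'cV[R]_d, V v <-> exists z : 'cV[R]_k, v = M *m z.

Definition ker_basis (R : realType) (a b k : nat) (X : 'M[R]_(a, b))
    (M : 'M[R]_(b, k)) : Prop :=
  columns_basis [set v : 'cV[R]_b | X *m v = 0]%classic M.

Definition col_space_basis (R : realType) (a b k : nat) (X : 'M[R]_(a, b))
    (M : 'M[R]_(a, k)) : Prop :=
  columns_basis [set X *m z | z in [set: 'cV[R]_b]]%classic M.

(* Main.v *)
(** Idea: let [(xi, eta)] annihilate the states and the inputs of every window
    of length [L] of the data. Shifting the window [i <= n] times and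
    substituting the dynamics yields an annihilator of the form
    [(xi A^i, eta, xi B, xi A B, ..., xi A^(i-1) B)] (up to reversal); the
    combination of these with the coefficients of the characteristic polynomial
    of [A] kills the states, so by persistency of excitation its input part
    vanishes too. That input part is a monic linear recurrence on the sequence
    [eta, xi B, xi A B, ...], preceded by [n] zeros, which is therefore zero, and
    controllability gives [xi = 0]. So initial state and inputs can be prescribed
    freely by a combination of data columns, whence the trajectories of length
    [Tini] are exactly the images of [col_mx Up Yp]. Solving [Up g = uini] turns
    [W] into [w0 - im (Yp NU)], and a real matrix [P] maps [im P^T]
    isomorphically onto [im P]. *)
Require Import Defs.
From HB Require Import structures.
From mathcomp Require Import all_boot all_order all_algebra.
From mathcomp Require Import classical_sets functions reals.
Set Implicit Arguments.
Unset Strict Implicit.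
Unset Printing Implicit Defensive.
Import GRing.Theory.
Local Open Scope ring_scope.

(** * Gram matrices over an ordered field *)

(** The diagonal entries of [M^T *m M] are sums of squares. *)
Lemma trmx_mulmx_eq0 (F : realFieldType) (a b : nat) (M : 'M[F]_(a, b)) :
  M^T *m M = 0 -> M = 0.
Proof.
move=> M0; apply/matrixP=> i j; rewrite mxE.
have /eqP : (M^T *m M) j j = 0 by rewrite M0 mxE.
rewrite mxE Num.Theory.psumr_eq0 => [/allP /(_ i)|c _].
  by rewrite mem_index_enum mxE mulf_eq0 orbb => /(_ isT) /eqP.
by rewrite mxE -expr2 Num.Theory.sqr_ge0.
Qed.

Lemma gram_mulmx_eq0 (F : realFieldType) (a b c : nat) (M : 'M[F]_(a, b))
    (v : 'M[F]_(b, c)) :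
  M^T *m (M *m v) = 0 -> M *m v = 0.
Proof.
by move=> Mv0; apply: trmx_mulmx_eq0; rewrite trmx_mul -mulmxA Mv0 mulmx0.
Qed.

Lemma row_free_gram_unit (F : realFieldType) (a b : nat) (M : 'M[F]_(a, b)) :
  row_free M -> M *m M^T \in unitmx.
Proof.
move=> freeM; rewrite -row_free_unit; apply: inj_row_free => v.
move/(congr1 trmx); rewrite !trmx_mul trmxK trmx0 -mulmxA.
rewrite -{1}[M]trmxK => /gram_mulmx_eq0 /(congr1 trmx).
rewrite trmx_mul !trmxK trmx0 => vM0.
by apply: (row_free_inj freeM); rewrite vM0 mul0mx.
Qed.

(** * Row-major positions in stacked vectors *)

Lemma index_allpairs (S T : eqType) (s : seq S) (t : seq T) (a : S) (b : T) :
  a \in s -> b \in t ->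
  index (a, b) [seq (x, y) | x <- s, y <- t] =
  (index a s * size t + index b t)%N.
Proof.
move=> sa tb; elim: s sa => // x s IHs; rewrite in_cons allpairs_cons index_cat.
rewrite /=; case: (eqVneq x a) => [->|neq_xa] /=.
  by move=> _; rewrite map_f // index_map // => y z [].
move=> /= sa; rewrite ifN; last first.
  by apply/mapP => -[y _ [eq_ax _]]; rewrite eq_ax eqxx in neq_xa.
by rewrite size_map IHs // mulSn addnA.
Qed.

(** Lets positions be compared across stackings with different numbers of blocks, whose index types
    differ. *)
Lemma val_mxvec_index (a b : nat) (i : 'I_a) (j : 'I_b) :
  val (mxvec_index i j) = (i * b + j)%N.
Proof.
rewrite /mxvec_index /= /enum_rank [enum_rank_in]unlock insubdK; last first.
  by rewrite -topredE /= cardE index_mem mem_enum.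
rewrite enumT unlock /= index_allpairs ?mem_enum //.
by rewrite size_enum_ord !index_enum_ord.
Qed.

(** * Recurrences and the Cayley-Hamilton relation *)

Lemma monic_recurrence_eq0 (F : nzRingType) (V : lmodType F) (q : {poly F})
    (n : nat) (e : nat -> V) :
    q \is monic -> size q = n.+1 ->
    (forall i, (i < n)%N -> e i = 0) ->
    (forall s, \sum_(i < n.+1) q`_i *: e (s + i)%N = 0) ->
  forall s, e s = 0.
Proof.
move=> /monicP; rewrite /lead_coef => + sz_q; rewrite sz_q /= => qn1 e0 rec s.
have [m] := ubnP s; elim: m s => // m IHm s; rewrite ltnS => le_sm.
have [/e0 //|le_ns] := ltnP s n.
have := rec (s - n)%N; rewrite big_ord_recr /= qn1 scale1r subnK //.
rewrite big1 ?add0r // => i _; rewrite IHm ?scaler0 //.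
by apply: leq_trans le_sm; rewrite -{2}(subnK le_ns) ltn_add2l.
Qed.

Lemma char_poly_powers_eq0 (F : comNzRingType) (n : nat) (A : 'M[F]_n) :
  \sum_(i < n.+1) (char_poly A)`_i *: A ^+ i = 0.
Proof.
case: n A => [|n] A; first by apply/matrixP => -[].
rewrite -[RHS](Cayley_Hamilton A) -[char_poly A in RHS]coefK poly_def.
rewrite size_char_poly linear_sum; apply: eq_bigr => i _.
by rewrite linearZ /= rmorphXn /= horner_mx_X.
Qed.

(** * Windows of a sequence as Hankel columns *)

(** Indexing by [nat] lets windows be shifted freely; in the sums below, values past the end only
    meet zero coefficients. *)
Definition extend0 (R : realType) (m T : nat) (v : 'I_T -> 'cV[R]_m) (k : nat) :
    'cV[R]_m :=
  if insub k is Some i then v i else 0.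

Lemma extend0E (R : realType) (m T : nat) (v : 'I_T -> 'cV[R]_m) (i : 'I_T) :
  extend0 v i = v i.
Proof. by rewrite /extend0 valK. Qed.

Lemma unstackE (R : realType) (m L : nat) (v : 'cV[R]_(L * m)) (k : 'I_L)
    (a : 'I_m) :
  unstack v k a 0 = v (mxvec_index k a) 0.
Proof. by rewrite !mxE. Qed.

Lemma unstack_inj (R : realType) (m L : nat) (v w : 'cV[R]_(L * m)) :
  (forall k, unstack v k = unstack w k) -> v = w.
Proof.
move=> eq_vw; apply/matrixP => r c; rewrite ord1.
by case/mxvec_indexP: r => k a; rewrite -!unstackE eq_vw.
Qed.

Lemma unstack_mulmx (R : realType) (m L N : nat) (M : 'M[R]_(L * m, N))
    (g : 'cV[R]_N) (k : 'I_L) :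
  unstack (M *m g) k = \sum_j g j 0 *: unstack (col j M) k.
Proof.
apply/matrixP => a c; rewrite ord1 unstackE mxE summxE.
by apply: eq_bigr => j _; rewrite mxE unstackE mxE mulrC.
Qed.

Lemma mul_row_stacked (R : realType) (m L : nat) (h : 'rV[R]_(L * m))
    (v : 'cV[R]_(L * m)) :
  h *m v = \sum_(k < L) row k (vec_mx h) *m unstack v k.
Proof.
apply/matrixP => a b; rewrite !ord1 mxE summxE.
rewrite (reindex _ (curry_mxvec_bij L m)) /=.
rewrite (eq_bigr (fun ka => h 0 (mxvec_index ka.1 ka.2) *
                            v (mxvec_index ka.1 ka.2) 0)); last by case.
rewrite -(pair_bigA _ (fun k a => h 0 (mxvec_index k a) *
                                  v (mxvec_index k a) 0)) /=.
by apply: eq_bigr => k _; rewrite mxE; apply: eq_bigr => c _; rewrite !mxE.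
Qed.

Lemma runs_extend0 (R : realType) (n m p T : nat) (G : ltiSystem R n m p)
    (u : 'I_T -> 'cV[R]_m) (x : nat -> 'cV[R]_n) (y : 'I_T -> 'cV[R]_p) :
    runs G u x y -> forall k, (k < T)%N ->
  x k.+1 = ltiA G *m x k + ltiB G *m extend0 u k /\
  extend0 y k = ltiC G *m x k + ltiD G *m extend0 u k.
Proof. by move=> run k ltkT; have := run (Ordinal ltkT); rewrite -!extend0E. Qed.

Lemma hankel_col (R : realType) (m T L : nat) (v : 'I_T -> 'cV[R]_m)
    (j : 'I_(T.+1 - L)) (k : 'I_L) :
  unstack (col j (hankel L v)) k = extend0 v (j + k)%N.
Proof.
rewrite -[(j + k)%N]/(val (hankel_ord j k)) extend0E.
by apply/matrixP => a c; rewrite ord1 unstackE !mxE mxvecE mxE.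
Qed.

(** The cast only retypes row indices, so entries are matched by their row-major positions. *)
Lemma hankel_upper_col (R : realType) (m T L1 L2 : nat) (v : 'I_T -> 'cV[R]_m)
    (Hp : 'M[R]_(L1 * m, T.+1 - (L1 + L2)))
    (Hf : 'M[R]_(L2 * m, T.+1 - (L1 + L2))) :
    col_mx Hp Hf = castmx (mulnDl L1 L2 m, erefl) (hankel (L1 + L2) v) ->
  forall j (k : 'I_L1), unstack (col j Hp) k = extend0 v (j + k)%N.
Proof.
move=> eqH j k; have := hankel_col v j (lshift L2 k); rewrite /= => <-.
apply/matrixP => a c; rewrite ord1 !unstackE [LHS]mxE [RHS]mxE.
have /matrixP/(_ (lshift _ (mxvec_index k a)) j) := eqH.
rewrite col_mxEu castmxE /= cast_ord_id => ->.
congr (hankel _ _ _ _); apply: val_inj => /=.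
by rewrite [LHS]val_mxvec_index [RHS]val_mxvec_index.
Qed.

(** * Annihilators of states and inputs *)

(** The blocks [c q] form one row in the left kernel of the Hankel matrix, whose columns are the [j]
    with [K + j <= T]. *)
Lemma persistently_exciting_annihilator (R : realType) (m T K : nat)
    (v : 'I_T -> 'cV[R]_m) (c : nat -> 'rV[R]_m) :
    persistently_exciting K v ->
    (forall j, (K + j <= T)%N ->
       \sum_(q < K) c q *m extend0 v (j + q)%N = 0) ->
  forall q, (q < K)%N -> c q = 0.
Proof.
move=> pe c0 q ltqK; pose h : 'rV_(K * m) := mxvec (\matrix_(k < K) c k).
have row_h k : row k (vec_mx h) = c k by rewrite mxvecK rowK.
suff h0 : h = 0 by rewrite -[q]/(val (Ordinal ltqK)) -row_h h0 linear0 row0.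
apply: (row_free_inj pe); rewrite mul0mx; apply/matrixP => a j; rewrite ord1.
have -> : (h *m hankel K v) 0 j = (h *m col j (hankel K v)) 0 0.
  by rewrite !mxE; apply: eq_bigr => i _; rewrite !mxE.
rewrite mul_row_stacked.
under eq_bigr => k _ do rewrite row_h hankel_col.
by rewrite c0 ?mxE // -ltnS -ltn_subRL.
Qed.

(** Induction on [i]: rewriting [x j.+1] by the dynamics turns [xi A^i] into [xi A^(i+1)] and adds
    the coefficient [xi A^i B] at [u j]; the zero [e i] drops the newest input, so the window keeps
    length [K]. *)
Lemma annihilator_shift (R : realType) (n m T L K : nat) (A : 'M[R]_n)
    (B : 'M[R]_(n, m)) (x : nat -> 'cV[R]_n) (u : nat -> 'cV[R]_m)
    (xi : 'rV[R]_n) (e : nat -> 'rV[R]_m) :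
    (forall k, (k < T)%N -> x k.+1 = A *m x k + B *m u k) ->
    (forall i, (i < n)%N -> e i = 0) ->
    (forall i, e (K + i)%N = xi *m A ^+ i *m B) ->
    (forall j, (L + j <= T)%N ->
       xi *m x j + \sum_(q < K) e q *m u (j + (K - q.+1))%N = 0) ->
  forall i j, (i <= n)%N -> (L + (i + j) <= T)%N ->
    xi *m A ^+ i *m x j + \sum_(q < K) e (q + i)%N *m u (j + (K - q.+1))%N = 0.
Proof.
move=> dyn e0 eK base; elim=> [|i IHi] j.
  move=> _ /base; rewrite expr0 mulmx1; apply: etrans.
  by congr (_ + _); apply: eq_bigr => q _; rewrite addn0.
move=> lt_in leT; have := IHi j.+1 (ltnW lt_in).
rewrite addnS -addSn => /(_ leT).
have lt_jT : (j < T)%N.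
  by apply: leq_trans leT; rewrite addSn addnS ltnS addnA leq_addl.
rewrite dyn // mulmxDr !mulmxA -[_ *m A in X in X -> _]mulmxA.
rewrite -[A ^+ i *m A]/(A ^+ i * A) -exprSr -eK -addrA.
apply: etrans; congr (_ + _).
(* This sum gives both sides: its first term vanishes by [e0], its last is the new term in [u j]. *)
transitivity (\sum_(q < K.+1) e (q + i)%N *m u (j + (K - q))%N).
  rewrite big_ord_recl /= e0 // mul0mx add0r.
  by apply: eq_bigr => q _; rewrite /bump /= add1n addSnnS.
rewrite big_ord_recr /= subnn addn0 addrC; congr (_ + _).
by apply: eq_bigr => q _; rewrite addSnnS subnSK.
Qed.

(** Along a run from the origin every [xi A^i] annihilates the state: one step raises [i] and adds a
    vanishing input term. Steering to unit vectors then exposes each entry of [xi]. *)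
Lemma controllable_annihilator (R : realType) (n m p : nat)
    (G : ltiSystem R n m p) (xi : 'rV[R]_n) :
  controllable G -> (forall i, xi *m ltiA G ^+ i *m ltiB G = 0) -> xi = 0.
Proof.
move=> ctrl xiAB0; apply/matrixP => a b.
have [T [u [x [y [run x0 xT]]]]] := ctrl 0 (delta_mx b 0).
suff : forall k, (k <= T)%N -> forall i, xi *m ltiA G ^+ i *m x k = 0.
  move=> /(_ T (leqnn T) 0%N); rewrite expr0 mulmx1 xT -colE.
  by move=> /matrixP /(_ a 0); rewrite !mxE.
elim=> [_ i|k IHk lt_kT i]; first by rewrite x0 mulmx0.
have [/= -> _] := run (Ordinal lt_kT); rewrite mulmxDr !mulmxA xiAB0 mul0mx addr0.
rewrite -[_ *m ltiA G]mulmxA -[_ ^+ i *m _]/(_ ^+ i * _) -exprSr.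
by rewrite IHk // ltnW.
Qed.

Lemma state_input_annihilator (R : realType) (n m p T L : nat)
    (G : ltiSystem R n m p) (v : 'I_T -> 'cV[R]_m) (x : nat -> 'cV[R]_n)
    (xi : 'rV[R]_n) (eta : nat -> 'rV[R]_m) :
    controllable G -> persistently_exciting (L + n) v ->
    (forall k, (k < T)%N ->
       x k.+1 = ltiA G *m x k + ltiB G *m extend0 v k) ->
    (forall j, (L + j <= T)%N ->
       xi *m x j + \sum_(t < L) eta t *m extend0 v (j + t)%N = 0) ->
  xi = 0 /\ forall t, (t < L)%N -> eta t = 0.
Proof.
move=> ctrl pe dyn ann; pose K := (L + n)%N.
(* [e] runs backwards in time, so that delaying the window by [i] steps reads
   [e] from index [i] on: the [n] leading zeros are the padding of the window
   from [L] to [L + n]. *)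
pose e q := if (q < n)%N then 0 else if (q < K)%N then eta (K - q.+1)%N
            else xi *m ltiA G ^+ (q - K) *m ltiB G.
have e_low i : (i < n)%N -> e i = 0 by rewrite /e => ->.
have e_mid t : (t < L)%N -> e (K - t.+1)%N = eta t.
  move=> lt_tL; have lt_tK : (t < K)%N by apply: leq_trans lt_tL (leq_addr _ _).
  rewrite /e ltnNge leq_subRL // leq_add2r lt_tL /=.
  by rewrite ltn_subrL /= (leq_trans _ lt_tK) // subnSK // subKn // ltnW.
have e_high i : e (K + i)%N = xi *m ltiA G ^+ i *m ltiB G.
  have le_n : (n <= K + i)%N by apply: leq_trans (leq_addl L n) (leq_addr _ _).
  by rewrite /e ltnNge le_n ltnNge leq_addr /= addKn.
pose a i := (char_poly (ltiA G))`_i.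
(* The input coefficients left when the shifted annihilators are combined by the characteristic
   polynomial. *)
pose S q := \sum_(i < n.+1) a i *: e (q + i)%N.
have S_high i : S (K + i)%N = 0.
  transitivity (xi *m (ltiA G ^+ i *m
                       \sum_(k < n.+1) a k *: ltiA G ^+ k) *m ltiB G).
    rewrite !mulmx_sumr mulmx_suml; apply: eq_bigr => k _.
    by rewrite -addnA e_high exprD -!scalemxAr -scalemxAl.
  by rewrite char_poly_powers_eq0 !mulmx0 mul0mx.
have base j : (L + j <= T)%N ->
    xi *m x j + \sum_(q < K) e q *m extend0 v (j + (K - q.+1))%N = 0.
  move=> /ann; apply: etrans; congr (_ + _).
  rewrite (reindex_inj rev_ord_inj) /= big_split_ord /= [X in _ + X]big1 => [|t _].
    rewrite addr0; apply: eq_bigr => t _; rewrite -/K e_mid // subnSK.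
      by rewrite subKn // (leq_trans (ltnW (ltn_ord t)) (leq_addr _ _)).
    exact: leq_trans (ltn_ord t) (leq_addr _ _).
  rewrite e_low ?mul0mx // /K -addnS subnDl ltn_subrL /=.
  exact: leq_ltn_trans (ltn_ord t).
have S_low q : (q < K)%N -> S q = 0.
  (* [c] undoes the time reversal, to match the order of the Hankel rows. *)
  move=> lt_qK; pose c r := S (K - r.+1)%N.
  have -> : S q = c (K - q.+1)%N by rewrite /c subnSK // subKn // ltnW.
  apply: (persistently_exciting_annihilator pe); last first.
    by rewrite ltn_subrL (leq_ltn_trans _ lt_qK).
  move=> j le_jT; rewrite (reindex_inj rev_ord_inj) /=.
  have shift (i : 'I_n.+1) :
      xi *m ltiA G ^+ i *m x j
      + \sum_(r < K) e (r + i)%N *m extend0 v (j + (K - r.+1))%N = 0.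
    apply: (annihilator_shift dyn e_low e_high base); first by rewrite -ltnS.
    by apply: leq_trans le_jT; rewrite addnA leq_add2r leq_add2l -ltnS.
  have : \sum_(i < n.+1) a i *:
      (xi *m ltiA G ^+ i *m x j
       + \sum_(r < K) e (r + i)%N *m extend0 v (j + (K - r.+1))%N) = 0.
    by rewrite big1 // => i _; rewrite shift scaler0.
  rewrite (eq_bigr (fun i : 'I_n.+1 => xi *m (a i *: ltiA G ^+ i) *m x j +
    \sum_(r < K) a i *: (e (r + i)%N *m extend0 v (j + (K - r.+1))%N))) => [|i _];
    last by rewrite scalerDr scaler_sumr -scalemxAr -scalemxAl.
  rewrite big_split /= -mulmx_suml -mulmx_sumr char_poly_powers_eq0.
  rewrite mulmx0 mul0mx add0r exchange_big /=; apply: etrans.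
  apply: eq_bigr => r _; rewrite /c subnSK // subKn ?(ltnW (ltn_ord r)) //.
  by rewrite mulmx_suml; apply: eq_bigr => i _; rewrite scalemxAl.
(* [S] vanishes below [K] by excitation and from [K] on by Cayley-Hamilton, so the [n] leading zeros
   of [e] propagate. *)
have e_eq0 : forall q, e q = 0.
  apply: (monic_recurrence_eq0 (char_poly_monic (ltiA G))) e_low _.
    exact: size_char_poly.
  move=> s; have [/S_low //|le_Ks] := ltnP s K.
  by rewrite -(subnKC le_Ks); apply: S_high.
split=> [|t /e_mid <- //].
by apply: (controllable_annihilator ctrl) => i; rewrite -e_high.
Qed.

(** * Data windows and trajectories *)

(** A left-kernel row splits into a state part and input blocks; since [K <= L], zero blocks pad the
    latter to a whole window, where [state_input_annihilator] applies. *)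
Lemma initial_state_input_row_free (R : realType) (n m p T L K : nat)
    (G : ltiSystem R n m p) (v : 'I_T -> 'cV[R]_m) (x : nat -> 'cV[R]_n)
    (Up : 'M[R]_(K * m, T.+1 - L)) :
    (K <= L)%N -> controllable G -> persistently_exciting (L + n) v ->
    (forall k, (k < T)%N ->
       x k.+1 = ltiA G *m x k + ltiB G *m extend0 v k) ->
    (forall j (k : 'I_K), unstack (col j Up) k = extend0 v (j + k)%N) ->
  row_free (col_mx (\matrix_(i < n, j < T.+1 - L) x j i 0) Up).
Proof.
move=> le_KL ctrl pe dyn colU; apply: inj_row_free => z.
rewrite -[z]hsubmxK mul_row_col; set xi := lsubmx z; set h := rsubmx z => z0.
pose eta t := if insub t is Some k then row k (vec_mx h) else 0.
have etaE (k : 'I_K) : eta k = row k (vec_mx h) by rewrite /eta valK.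
have [j le_jT|-> eta0] :=
  @state_input_annihilator _ _ _ _ T L G v x xi eta ctrl pe dyn.
  have lt_j : (j < T.+1 - L)%N by rewrite ltn_subRL ltnS.
  have /(congr1 (col (Ordinal lt_j))) := z0.
  rewrite linearD col0 /= !colE -!mulmxA -!colE mul_row_stacked.
  apply: etrans; congr (_ + _).
    by congr (_ *m _); apply/matrixP => a b; rewrite ord1 !mxE.
  rewrite -(big_mkord xpredT (fun t => eta t *m extend0 v (j + t)%N)).
  rewrite (big_cat_nat (leq0n K) le_KL) //= big_mkord [X in _ + X]big_nat_cond.
  rewrite [X in _ + X]big1 => [|t /andP[/andP[le_Kt _] _]].
    by rewrite addr0; apply: eq_bigr => k _; rewrite etaE colU.
  by rewrite /eta insubF ?mul0mx // ltnNge le_Kt.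
suff -> : h = 0 by rewrite row_mx0.
rewrite -[h]vec_mxK; suff -> : vec_mx h = 0 by rewrite linear0.
apply/row_matrixP => k; rewrite -etaE row0 eta0 //.
exact: leq_trans (ltn_ord k) le_KL.
Qed.

(** Willems' fundamental lemma for the first [K] steps of each window. Combined windows are
    trajectories by linearity; conversely, matching the initial state and the inputs forces the
    outputs to agree. *)
Lemma trajectory_data_image (R : realType) (n m p T L K : nat)
    (G : ltiSystem R n m p) (v : 'I_T -> 'cV[R]_m) (w : 'I_T -> 'cV[R]_p)
    (Up : 'M[R]_(K * m, T.+1 - L)) (Yp : 'M[R]_(K * p, T.+1 - L))
    (a : 'cV[R]_(K * m)) (b : 'cV[R]_(K * p)) :
    (K <= L)%N -> controllable G -> persistently_exciting (L + n) v ->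
    trajectory G v w ->
    (forall j (k : 'I_K), unstack (col j Up) k = extend0 v (j + k)%N) ->
    (forall j (k : 'I_K), unstack (col j Yp) k = extend0 w (j + k)%N) ->
  trajectory G (unstack a) (unstack b) <->
  exists2 g, Up *m g = a & Yp *m g = b.
Proof.
move=> le_KL ctrl pe [x run] colU colY.
have run0 := runs_extend0 run; have dyn k ltkT := proj1 (run0 k ltkT).
have window (j : 'I_(T.+1 - L)) (k : 'I_K) : (j + k < T)%N.
  have := ltn_ord j; rewrite ltn_subRL ltnS; apply: leq_trans.
  by rewrite addnC ltn_add2r (leq_trans (ltn_ord k)).
pose xg (g : 'cV[R]_(T.+1 - L)) t := \sum_j g j 0 *: x (j + t)%N.
have run_xg g : runs G (unstack (Up *m g)) (xg g) (unstack (Yp *m g)).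
  move=> k; rewrite !unstack_mulmx /xg !mulmx_sumr -!big_split /=.
  split; apply: eq_bigr => j _; rewrite -!scalemxAr -scalerDr colU ?colY.
    by rewrite addnS dyn.
  by have [_ ->] := run0 _ (window j k).
split=> [[z run_z]|[g <- <-]]; last by exists (xg g).
(* A right inverse prescribes the initial state [z 0] and the inputs [a] at once. *)
have /row_freeP [M freeM] := initial_state_input_row_free le_KL ctrl pe dyn colU.
pose g := M *m col_mx (z 0%N) a.
have : col_mx (\matrix_(i < n, j < T.+1 - L) x j i 0) Up *m g = col_mx (z 0%N) a.
  by rewrite mulmxA freeM mul1mx.
rewrite mul_col_mx => /eq_col_mx [xg0 Ug]; exists g => //.
have eq_xz : forall t, (t <= K)%N -> xg g t = z t.
  elim=> [_|t IHt lt_tK].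
    rewrite -xg0; apply/matrixP => i c; rewrite ord1 mxE summxE.
    by apply: eq_bigr => j _; rewrite !mxE addn0 mulrC.
  have [-> _] := run_xg g (Ordinal lt_tK); have [-> _] := run_z (Ordinal lt_tK).
  by rewrite Ug /= IHt // ltnW.
apply: unstack_inj => k; have [_ ->] := run_xg g k; have [_ ->] := run_z k.
by rewrite Ug eq_xz // ltnW.
Qed.

(** * Parametrization of the admissible [w] *)

(** [P] is injective on the range of [P^T], because [P P^T y = 0] forces [P^T y = 0]. So [P *m Q]
    has the rank of [P], and its column space, contained in that of [P], equals it. *)
Lemma row_space_basis_image (F : realType) (a b : nat) (P : 'M[F]_(a, b))
    (Q : 'M[F]_(b, \rank P)) :
    col_space_basis P^T Q ->
  (forall g : 'cV[F]_(\rank P), P *m Q *m g = 0 -> g = 0) /\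
  (forall z : 'cV[F]_b, exists g, P *m z = P *m Q *m g).
Proof.
move=> [fullQ spanQ].
have PQ_inj (g : 'cV[F]_(\rank P)) : P *m Q *m g = 0 -> g = 0.
  have [z _ Qg] : [set P^T *m z | z in [set: 'cV[F]_a]]%classic (Q *m g).
    by apply/spanQ; exists g.
  rewrite -mulmxA -Qg -{1}[P]trmxK => /gram_mulmx_eq0; rewrite Qg => Qg0.
  by have [M MQ] := row_fullP fullQ; rewrite -[g]mul1mx -MQ -mulmxA Qg0 mulmx0.
split=> // z.
have freePQ : row_free (P *m Q)^T.
  apply: inj_row_free => g /(congr1 trmx).
  rewrite trmx_mul trmxK trmx0 => /PQ_inj /(congr1 trmx).
  by rewrite trmxK trmx0.
have sPQ : ((P *m Q)^T <= P^T)%MS by rewrite trmx_mul submxMl.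
have : (P^T <= (P *m Q)^T)%MS.
  rewrite -(geq_leqif (mxrank_leqif_sup sPQ)) mxrank_tr.
  by rewrite (eqP freePQ).
move=> /(submx_trans (submxMl z^T _)) /submxP [g eq_g].
by exists g^T; rewrite -[LHS]trmxK trmx_mul eq_g trmx_mul trmxK.
Qed.

Theorem theorem10 (R : realType) (n m p : nat) (G : ltiSystem R n m p)
  (Tini Tf Td l : nat)
  (ubar : 'I_Td -> 'cV[R]_m) (ybar : 'I_Td -> 'cV[R]_p)
  (Up : 'M[R]_(Tini * m, Td.+1 - (Tini + Tf)))
  (Uf : 'M[R]_(Tf * m, Td.+1 - (Tini + Tf)))
  (Yp : 'M[R]_(Tini * p, Td.+1 - (Tini + Tf)))
  (Yf : 'M[R]_(Tf * p, Td.+1 - (Tini + Tf)))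
  (uini : 'cV[R]_(Tini * m)) (yini : 'cV[R]_(Tini * p))
  (k : nat) (NU : 'M[R]_(Td.+1 - (Tini + Tf), k))
  (RW : 'M[R]_(k, \rank (Yp *m NU)))
  (hctrl : controllable G) (hobs : observable G)
  (hdata : trajectory G ubar ybar)
  (hU : col_mx Up Uf =
        castmx (mulnDl Tini Tf m, erefl) (hankel (Tini + Tf) ubar))
  (hY : col_mx Yp Yf =
        castmx (mulnDl Tini Tf p, erefl) (hankel (Tini + Tf) ybar))
  (hpe : persistently_exciting (Tini + Tf + n) ubar)
  (hlag : is_lag G l) (hTini : (l <= Tini)%N)
  (hNU : ker_basis Up NU)
  (hRW : col_space_basis (NU^T *m Yp^T) RW) :
  let gini := Up^T *m invmx (Up *m Up^T) *m uini in
  let w0 := yini - Yp *m gini in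
  let W : set 'cV[R]_(Tini * p) :=
    [set w | trajectory G (unstack uini) (unstack (yini - w))]%classic in
  let nw := \rank (Yp *m NU) in
  let f := fun gw : 'cV[R]_nw => - Yp *m NU *m RW *m gw + w0 in
  (forall w : 'cV[R]_(Tini * p), W w <-> exists gw : 'cV[R]_nw, w = f gw) /\
  set_bij [set: 'cV[R]_nw]%classic W f.
Proof.
move=> gini w0 W nw f.
have colU := hankel_upper_col hU; have colY := hankel_upper_col hY.
have le_TiniL : (Tini <= Tini + Tf)%N by exact: leq_addr.
have [x run] := hdata.
have dyn t ltT := proj1 (runs_extend0 run (k := t) ltT).
have free_XU := initial_state_input_row_free le_TiniL hctrl hpe dyn colU.
(* A left-kernel row of [Up], given a zero state part, is one of the state-input matrix. *)
have freeU : row_free Up.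
  apply: inj_row_free => z zU0; have := row_free_inj free_XU.
  move=> /(_ _ (row_mx 0 z) 0); rewrite mul_row_col mul0mx add0r zU0 mul0mx.
  by move=> /(_ erefl); rewrite -row_mx0 => /eq_row_mx [].
have Ugini : Up *m gini = uini.
  by rewrite !mulmxA mulmxV ?mul1mx // row_free_gram_unit.
have [_ kerU] := hNU.
have hRWt : col_space_basis (Yp *m NU)^T RW by rewrite trmx_mul.
have [PRW_inj PRW_im] := row_space_basis_image hRWt.
have WP w : W w <-> exists gw, w = f gw.
  have trajP :=
    trajectory_data_image uini (yini - w) le_TiniL hctrl hpe hdata colU colY.
  split=> [/trajP [g Ug Yg]|[gw wE]].
    (* Any solution [g] differs from the particular solution [gini] by some [NU *m z]; [PRW_im]
       replaces [z] by [RW *m gw] with the same image under [Yp *m NU]. *)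
    have /kerU [z gE] : (Up *m (g - gini) = 0) by rewrite mulmxBr Ug Ugini subrr.
    have [gw PzE] := PRW_im z; exists gw.
    rewrite /f /w0 !mulNmx -PzE -mulmxA -gE mulmxBr Yg.
    by rewrite opprB [RHS]addrC subrKA subKr.
  apply/trajP; exists (gini + NU *m (RW *m gw)).
    have kerz : Up *m (NU *m (RW *m gw)) = 0 by apply/kerU; exists (RW *m gw).
    by rewrite mulmxDr Ugini kerz addr0.
  rewrite wE /f /w0 !mulNmx mulmxDr !mulmxA opprD opprK opprB.
  by rewrite [RHS]addrC -addrA subrK addrC.
split=> //; split.
- by move=> gw _; apply/WP; exists gw.
- move=> g1 g2 _ _ /addIr; rewrite !mulNmx => /oppr_inj /eqP.
  by rewrite -subr_eq0 -mulmxBr => /eqP /PRW_inj /eqP; rewrite subr_eq0 => /eqP.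
- by move=> w /WP [gw ->]; exists gw.
Qed.
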